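(* Let $U$ be an ultrafilter over the four-element Boolean algebra $B_4^\circ$ expanded with $\circledcirc$. For every set of formulas $\Gamma\cup\{\varphi\}\subseteq \mathrm{Form}(\mathcal{L}^\circ)$, $$\Gamma\vDash\varphi \text{ if, and only if, } \Gamma\vdash\varphi,$$ where $\vDash$ is the semantic consequence given by valuations in $B_4^\circ$ with designated set $U$, and $\vdash$ is derivability in the axiomatic system $\mathcal{B}_4^\circ$.
   Context: Language: $\mathrm{Form}(\mathcal{L}^\circ)$ is the set of propositional formulas built from a set of variables $\mathrm{Var}$ with unary connectives $\neg,\circ$ and binary connectives $\wedge,\vee$. Abbreviations: $\varphi\to\psi := \neg\varphi\vee\psi$ and $\varphi\leftrightarrow\psi := (\varphi\to\psi)\wedge(\psi\to\varphi)$. Semantics: in a Boolean algebra write $1$ (top), $0$ (bottom), $+$ (join), $\cdot$ (meet), $-$ (complement). $B_4^\circ$ is the four-element Boolean algebra expanded by the unary operation $\circledcirc$ with $\circledcirc x=1$ if $x\in\{0,1\}$ and $\circledcirc x=0$ otherwise. A valuation is a function $v:\mathrm{Form}(\mathcal{L}^\circ)\to B_4^\circ$ with $v(\neg\varphi)=-v(\varphi)$, $v(\circ\varphi)=\circledcirc(v(\varphi))$, $v(\varphi\vee\psi)=v(\varphi)+v(\psi)$, $v(\varphi\wedge\psi)=v(\varphi)\cdot v(\psi)$. A valuation $v$ satisfies $\varphi$ when $v(\varphi)\in U$. $\Gamma\vDash\varphi$ means that every valuation satisfying all formulas of $\Gamma$ satisfies $\varphi$. The system $\mathcal{B}_4^\circ$: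 $\Gamma\vdash\varphi$ means that $\varphi$ is derivable from $\Gamma$ using the following axioms and rules, for all formulas $\varphi,\psi$: (CL) the axioms and rules of classical propositional logic for the extended language (including modus ponens); (DB) $\vdash\circ\circ\varphi$; (BR) $\circ\varphi\dashv\vdash\circ\neg\varphi$; (BF) $\circ\varphi,\circ\psi\vdash\circ(\varphi\wedge\psi)$ and $\circ\varphi,\circ\psi\vdash\circ(\varphi\vee\psi)$; (AwB) $\varphi,\circ\varphi\vdash\circ(\varphi\vee\psi)$; (NwB) $\neg\varphi,\circ\varphi\vdash\circ(\varphi\wedge\psi)$; (NB) $\neg\circ\varphi,\circ\psi\vdash\neg\circ(\varphi\wedge\psi)\vee\neg\circ(\varphi\vee\psi)$; (TNB1) $\neg\circ\varphi,\neg\circ\psi,\varphi\wedge\psi\vdash\neg\circ(\varphi\wedge\psi)$; (TNB2) $\neg\circ\varphi,\neg\circ\psi,\neg(\varphi\vee\psi)\vdash\neg\circ(\varphi\wedge\psi)$; (BC) $\circ(\varphi\wedge\psi),\varphi\wedge\psi\vdash\circ\varphi\wedge\circ\psi$; (OV) $\circ\varphi\leftrightarrow\circ\psi,\ \varphi\leftrightarrow\neg\psi\vdash\circ(\varphi\wedge\psi)$; (IB) if $\vdash\varphi$ (derivable from no premises), then $\vdash\circ\varphi$. *)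

(* Defs.v *)
From mathcomp Require Import all_boot all_order.
From mathcomp Require Import boolp classical_sets.

Set Implicit Arguments.
Unset Strict Implicit.
Unset Printing Implicit Defensive.

Import Order.TTheory.

Local Open Scope classical_set_scope.

Section Ultrafilter.
Context {d : Order.disp_t} {L : tbLatticeType d}.
Local Open Scope order_scope.

Definition proper_lattice_filter (F : set L) : Prop :=
  [/\ F \top, ~ F \bot,
      (forall x y, F x -> F y -> F (Order.meet x y))
    & (forall x y, x <= y -> F x -> F y)].

Definition lattice_ultrafilter (F : set L) : Prop :=
  proper_lattice_filter F /\
  forall G : set L, proper_lattice_filter G -> F `<=` G -> G = F.

End Ultrafilter.

Inductive form (V : Type) : Type :=
| Var of V
| Neg of form V
| Circ of form V
| And of form V & form V
| Or of form V & form V.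

Definition Imp (V : Type) (phi psi : form V) : form V := Or (Neg phi) psi.
Definition Iff (V : Type) (phi psi : form V) : form V :=
  And (Imp phi psi) (Imp psi phi).

(* [*p] carries the componentwise order, so this is the Boolean algebra 2 x 2. *)
Definition B4 : finCTBDistrLatticeType _ := (bool *p bool)%type.

Definition ocirc (x : B4) : B4 :=
  if (x == Order.bottom) || (x == Order.top) then Order.top else Order.bottom.

Record valuation (V : Type) (v : form V -> B4) : Prop := Valuation {
  val_neg : forall phi, v (Neg phi) = Order.compl (v phi);
  val_circ : forall phi, v (Circ phi) = ocirc (v phi);
  val_or : forall phi psi, v (Or phi psi) = Order.join (v phi) (v psi);
  val_and : forall phi psi, v (And phi psi) = Order.meet (v phi) (v psi)
}.

Definition entails (V : Type) (U : set B4) (Gamma : set (form V))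
    (phi : form V) : Prop :=
  forall v : form V -> B4, valuation v ->
    (forall gamma, Gamma gamma -> U (v gamma)) -> U (v phi).

(* Classical logic is given by natural deduction, with discharge of hypotheses.
   This matters: [derives] then has the deduction property, so that each rule
   [phi_1, .., phi_n |- psi] on [Circ] also yields the theorem
   [|- phi_1 -> .. -> phi_n -> psi].  Only [der_IB] requires its premise to be
   derivable from no hypotheses. *)
Inductive derives (V : Type) : set (form V) -> form V -> Prop :=
| der_hyp Gamma phi : Gamma phi -> derives Gamma phi
| der_ImpI Gamma phi psi :
    derives (Gamma `|` [set phi]) psi -> derives Gamma (Imp phi psi)
| der_MP Gamma phi psi :
    derives Gamma (Imp phi psi) -> derives Gamma phi -> derives Gamma psi
| der_AndI Gamma phi psi :
    derives Gamma phi -> derives Gamma psi -> derives Gamma (And phi psi)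
| der_AndE1 Gamma phi psi : derives Gamma (And phi psi) -> derives Gamma phi
| der_AndE2 Gamma phi psi : derives Gamma (And phi psi) -> derives Gamma psi
| der_OrI1 Gamma phi psi : derives Gamma phi -> derives Gamma (Or phi psi)
| der_OrI2 Gamma phi psi : derives Gamma psi -> derives Gamma (Or phi psi)
| der_OrE Gamma phi psi chi :
    derives Gamma (Or phi psi) ->
    derives (Gamma `|` [set phi]) chi -> derives (Gamma `|` [set psi]) chi ->
    derives Gamma chi
| der_NegI Gamma phi psi :
    derives (Gamma `|` [set phi]) psi ->
    derives (Gamma `|` [set phi]) (Neg psi) ->
    derives Gamma (Neg phi)
| der_RAA Gamma phi psi :
    derives (Gamma `|` [set Neg phi]) psi ->
    derives (Gamma `|` [set Neg phi]) (Neg psi) ->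
    derives Gamma phi
| der_DB Gamma phi : derives Gamma (Circ (Circ phi))
| der_BR1 Gamma phi :
    derives Gamma (Circ phi) -> derives Gamma (Circ (Neg phi))
| der_BR2 Gamma phi :
    derives Gamma (Circ (Neg phi)) -> derives Gamma (Circ phi)
| der_BF_And Gamma phi psi :
    derives Gamma (Circ phi) -> derives Gamma (Circ psi) ->
    derives Gamma (Circ (And phi psi))
| der_BF_Or Gamma phi psi :
    derives Gamma (Circ phi) -> derives Gamma (Circ psi) ->
    derives Gamma (Circ (Or phi psi))
| der_AwB Gamma phi psi :
    derives Gamma phi -> derives Gamma (Circ phi) ->
    derives Gamma (Circ (Or phi psi))
| der_NwB Gamma phi psi :
    derives Gamma (Neg phi) -> derives Gamma (Circ phi) ->
    derives Gamma (Circ (And phi psi))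
| der_NB Gamma phi psi :
    derives Gamma (Neg (Circ phi)) -> derives Gamma (Circ psi) ->
    derives Gamma (Or (Neg (Circ (And phi psi))) (Neg (Circ (Or phi psi))))
| der_TNB1 Gamma phi psi :
    derives Gamma (Neg (Circ phi)) -> derives Gamma (Neg (Circ psi)) ->
    derives Gamma (And phi psi) ->
    derives Gamma (Neg (Circ (And phi psi)))
| der_TNB2 Gamma phi psi :
    derives Gamma (Neg (Circ phi)) -> derives Gamma (Neg (Circ psi)) ->
    derives Gamma (Neg (Or phi psi)) ->
    derives Gamma (Neg (Circ (And phi psi)))
| der_BC Gamma phi psi :
    derives Gamma (Circ (And phi psi)) -> derives Gamma (And phi psi) ->
    derives Gamma (And (Circ phi) (Circ psi))
| der_OV Gamma phi psi :
    derives Gamma (Iff (Circ phi) (Circ psi)) ->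
    derives Gamma (Iff phi (Neg psi)) ->
    derives Gamma (Circ (And phi psi))
| der_IB Gamma phi : derives set0 phi -> derives Gamma (Circ phi).

(* Main.v *)
Require Import Defs.
From mathcomp Require Import all_boot all_order.
From mathcomp Require Import boolp classical_sets.

(** [B4] is the Boolean algebra [2 x 2], its only ultrafilters are the preimages
    of [true] under the two coordinates, and exchanging the coordinates is an
    automorphism of [B4] that commutes with [ocirc].  So entailment does not
    depend on the ultrafilter, and one may take [U] to be the set of values
    whose first coordinate is [true].

    Soundness is then a check of truth tables, except for the rule (IB).  There
    a theorem [phi] has first coordinate [true] under every valuation [v]; as
    [swap \o v] is again a valuation, the second coordinate of [v phi] is [true]
    too, so [v phi] is the top element and [Circ phi] is satisfied.

    For completeness, extend [Gamma] to a complete theory [D] that omits the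
    underivable [phi] ([lindenbaum]).  A value [x] of [B4] is determined by
    its first coordinate together with the truth of [ocirc x], which says that
    the coordinates agree.  This forces the definition of the valuation read off
    from [D]: the first coordinate of [canonical D chi] records whether [chi] is
    in [D], and the second agrees with it exactly when [Circ chi] is in [D].

    That [canonical] preserves the meet amounts to computing the truth of
    [Circ (And a b)] in [D] from those of [a], [b], [Circ a] and [Circ b].  If
    both [Circ a] and [Circ b] are true, (BF) does so; if neither, (TNB1),
    (TNB2) and (OV) do ([truth_Circ_And_gap]); if exactly one, (NwB) or (AwB)
    and (NB) do ([truth_Circ_And_mixed]).  The rules are not symmetric in [a]
    and [b] and mostly speak of conjunction, so one also needs that [Circ]
    respects provable equivalence ([Circ_replacement]).  With it conjuncts may
    be exchanged, and disjunction is reduced to negation and conjunction by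
    De Morgan's law. *)

Set Implicit Arguments.
Unset Strict Implicit.
Unset Printing Implicit Defensive.

Local Open Scope classical_set_scope.

(** * The algebra B4 and its two ultrafilters *)

Definition coord1 (x : B4) : bool := x.1.
Definition coord2 (x : B4) : bool := x.2.

Lemma coord1_compl (x : B4) : coord1 (Order.compl x) = ~~ coord1 x.
Proof. by case: x => [[] []]. Qed.

Lemma coord2_compl (x : B4) : coord2 (Order.compl x) = ~~ coord2 x.
Proof. by case: x => [[] []]. Qed.

Lemma coord1_meet (x y : B4) : coord1 (Order.meet x y) = coord1 x && coord1 y.
Proof. by case: x y => [[] []] [[] []]. Qed.

Lemma coord2_meet (x y : B4) : coord2 (Order.meet x y) = coord2 x && coord2 y.
Proof. by case: x y => [[] []] [[] []]. Qed.

Lemma coord1_join (x y : B4) : coord1 (Order.join x y) = coord1 x || coord1 y.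
Proof. by case: x y => [[] []] [[] []]. Qed.

Lemma coord2_join (x y : B4) : coord2 (Order.join x y) = coord2 x || coord2 y.
Proof. by case: x y => [[] []] [[] []]. Qed.

Lemma coord1_ocirc (x : B4) : coord1 (ocirc x) = (coord1 x == coord2 x).
Proof. by case: x => [[] []]. Qed.

Lemma coord2_ocirc (x : B4) : coord2 (ocirc x) = (coord1 x == coord2 x).
Proof. by case: x => [[] []]. Qed.

Definition B4E := (coord1_compl, coord2_compl, coord1_meet, coord2_meet,
  coord1_join, coord2_join, coord1_ocirc, coord2_ocirc).

Lemma B4_eq (x y : B4) : coord1 x = coord1 y -> coord2 x = coord2 y -> x = y.
Proof. by case: x y => [x1 x2] [y1 y2] /= -> ->. Qed.

Lemma B4_le (x y : B4) :
  (x <= y)%O -> (coord1 x -> coord1 y) /\ (coord2 x -> coord2 y).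
Proof. by case: x y => [[] []] [[] []]. Qed.

Definition coord1_set : set B4 := [set x : B4 | coord1 x].
Definition coord2_set : set B4 := [set x : B4 | coord2 x].

Lemma coord1_set_proper_filter : proper_lattice_filter coord1_set.
Proof.
split=> // [x y /= x1 y1 | x y /B4_le[le1 _] /= x1]; last exact: le1.
by move: x1 y1; case: x y => [[] []] [[] []].
Qed.

Lemma coord2_set_proper_filter : proper_lattice_filter coord2_set.
Proof.
split=> // [x y /= x2 y2 | x y /B4_le[_ le2] /= x2]; last exact: le2.
by move: x2 y2; case: x y => [[] []] [[] []].
Qed.

(** If some [x] in [U] has first coordinate [false], then no [y] in [U] has
    second coordinate [false], for the meet of [x] and [y] would be the bottom
    element.  So [U] lies in one of the two coordinate filters, and equals it by
    maximality. *)
Lemma B4_ultrafilter (U : set B4) :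
  lattice_ultrafilter U -> U = coord1_set \/ U = coord2_set.
Proof.
move=> [[_ U0 UI _] Umax].
have [U1|/existsNP[x /not_implyP[Ux /negP x1]]] := pselect (U `<=` coord1_set).
  by left; rewrite (Umax _ coord1_set_proper_filter U1).
right; rewrite (Umax _ coord2_set_proper_filter) // => y Uy /=.
apply/negPn/negP => y2; apply: U0.
rewrite (_ : Order.bottom = Order.meet x y); first exact: UI.
by apply: B4_eq; rewrite B4E ?(negbTE x1) ?(negbTE y2) ?andbF.
Qed.

Definition swap (x : B4) : B4 := (coord2 x, coord1 x).

Lemma coord1_swap (x : B4) : coord1 (swap x) = coord2 x.
Proof. by []. Qed.

Lemma coord2_swap (x : B4) : coord2 (swap x) = coord1 x.
Proof. by []. Qed.

Lemma valuation_swap (V : Type) (v : form V -> B4) :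
  valuation v -> valuation (swap \o v).
Proof.
move=> [vN vC vO vA].
split=> * /=; rewrite (vN, vC, vO, vA); apply: B4_eq;
  rewrite !(coord1_swap, coord2_swap, B4E) //; exact: eq_sym.
Qed.

Lemma entails_swap (V : Type) (Gamma : set (form V)) (phi : form V) :
  entails coord2_set Gamma phi <-> entails coord1_set Gamma phi.
Proof.
by split=> ent v vV vG; apply: (ent _ (valuation_swap vV)).
Qed.

(** * Soundness *)

Lemma soundness (V : Type) (Gamma : set (form V)) (phi : form V) :
  derives Gamma phi -> entails coord1_set Gamma phi.
Proof.
have entU (D : set (form V)) (a b : form V) v : valuation v ->
    (forall g, D g -> coord1_set (v g)) ->
    entails coord1_set (D `|` [set a]) b ->
    coord1 (v a) -> coord1 (v b).
  by move=> vV vD ent va; apply: ent => // g [/vD //|->].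
elim=> {Gamma phi}.
all: rewrite /coord1_set /=.
- by move=> D a Da v vV; apply.
- move=> D a b _ IH v vV vD; have := entU _ _ _ _ vV vD IH.
  by rewrite /= !(val_or, val_neg) // !B4E; case: (coord1 (v a)) => // ->.
- move=> D a b _ IH1 _ IH2 v vV vD; move: (IH1 _ vV vD) (IH2 _ vV vD).
  by rewrite /= !(val_or, val_neg) // !B4E; case: (coord1 (v a)).
- move=> D a b _ IH1 _ IH2 v vV vD; move: (IH1 _ vV vD) (IH2 _ vV vD).
  by rewrite /= val_and // !B4E => -> ->.
- move=> D a b _ IH v vV vD; move: (IH _ vV vD).
  by rewrite /= val_and // !B4E => /andP[].
- move=> D a b _ IH v vV vD; move: (IH _ vV vD).
  by rewrite /= val_and // !B4E => /andP[].
- move=> D a b _ IH v vV vD; move: (IH _ vV vD).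
  by rewrite /= val_or // !B4E => ->.
- move=> D a b _ IH v vV vD; move: (IH _ vV vD).
  by rewrite /= val_or // !B4E orbC => ->.
- move=> D a b c _ IH _ IHa _ IHb v vV vD; move: (IH _ vV vD).
  rewrite /= val_or // !B4E => /orP[]; first exact: entU IHa.
  exact: entU IHb.
- move=> D a b _ IH1 _ IH2 v vV vD.
  move: (entU _ _ _ _ vV vD IH1) (entU _ _ _ _ vV vD IH2).
  rewrite /= !val_neg // !B4E.
  by case: (coord1 (v a)) => // -> // /(_ isT).
- move=> D a b _ IH1 _ IH2 v vV vD.
  move: (entU _ _ _ _ vV vD IH1) (entU _ _ _ _ vV vD IH2).
  rewrite /= !val_neg // !B4E.
  by case: (coord1 (v a)) => // -> // /(_ isT).
(* The rules on [Circ] other than (DB) and (IB) are truth-table checks. *)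
all: try by move=> D a b _ IH1 _ IH2 _ IH3 v vV vD;
  move: (IH1 _ vV vD) (IH2 _ vV vD) (IH3 _ vV vD);
  rewrite /= !(val_circ, val_or, val_and, val_neg) // !B4E;
  case: (v a) (v b) => [[] []] [[] []].
all: try by move=> D a b _ IH1 _ IH2 v vV vD;
  move: (IH1 _ vV vD) (IH2 _ vV vD);
  rewrite /= ?/Iff ?/Imp !(val_circ, val_or, val_and, val_neg) // !B4E;
  case: (v a) (v b) => [[] []] [[] []].
all: try by move=> D a _ IH1 v vV vD;
  move: (IH1 _ vV vD);
  rewrite /= !(val_circ, val_or, val_and, val_neg) // !B4E;
  case: (v a) => [[] []].
- by move=> D a v vV vD; rewrite /= !val_circ // !B4E eqxx.
(* (IB): the induction hypothesis is used at [v] and at [swap \o v]. *)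
- move=> D a _ IH v vV vD; rewrite /= val_circ // B4E.
  have -> : coord1 (v a) by apply: IH.
  have /= -> // : coord1 ((swap \o v) a).
  by apply: IH => //; apply: valuation_swap.
Qed.

(** * Weakening and compactness *)

Lemma weakening (V : Type) (Gamma Delta : set (form V)) (phi : form V) :
  derives Gamma phi -> Gamma `<=` Delta -> derives Delta phi.
Proof.
move=> d; elim: d Delta => {Gamma phi}.
- by move=> D a Da E DE; apply/der_hyp/DE.
all: by move=> *; econstructor; eauto using setSU.
Qed.

Definition directed (T : Type) (F : set (set T)) : Prop :=
  F !=set0 /\
  forall X Y, F X -> F Y -> exists Z, [/\ F Z, X `<=` Z & Y `<=` Z].

Definition upward (T : Type) (P : set (set T)) : Prop :=
  forall X Y, X `<=` Y -> P X -> P Y.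

Lemma upward_and (T : Type) (P Q : set (set T)) :
  upward P -> upward Q -> upward (fun X => P X /\ Q X).
Proof.
by move=> upP upQ X Y XY [PX QX]; split; [apply: upP PX | apply: upQ QX].
Qed.

Lemma directed_and (T : Type) (F P Q : set (set T)) :
  directed F -> upward P -> upward Q ->
  (exists2 X, F X & P X) -> (exists2 Y, F Y & Q Y) ->
  exists2 Z, F Z & P Z /\ Q Z.
Proof.
move=> [_ dirF] upP upQ [X FX PX] [Y FY QY].
have [Z [FZ XZ YZ]] := dirF _ _ FX FY.
by exists Z => //; split; [apply: upP PX | apply: upQ QY].
Qed.

Lemma directed_setU (T : Type) (F : set (set T)) (A : set T) :
  directed F -> directed [set X `|` A | X in F].
Proof.
move=> [[X FX] dirF]; split; first by exists (X `|` A), X.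
move=> _ _ [Y FY <-] [Z FZ <-]; have [W [FW YW ZW]] := dirF _ _ FY FZ.
by exists (W `|` A); split; [exists W | apply: setSU | apply: setSU].
Qed.

(** The formulation with directed unions instead of finite sets of hypotheses
    suits the induction: discharging [a] replaces the family [F] by that of the
    sets [X `|` [set a]], which is again directed, and several premises are
    gathered in one member of [F] by [directed_and].  It also applies directly
    to the chains of Zorn's lemma. *)
Lemma compactness (V : Type) (Gamma : set (form V)) (phi : form V) :
  derives Gamma phi ->
  forall F : set (set (form V)), directed F -> Gamma `<=` \bigcup_(X in F) X ->
  exists2 X, F X & derives X phi.
Proof.
have up a : upward (fun X : set (form V) => derives X a).
  by move=> X Y XY Xa; apply: weakening XY.
have upU b a : upward (fun X : set (form V) => derives (X `|` [set b]) a).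
  by move=> X Y XY Xa; apply: weakening Xa _; apply: setSU.
have disch F (D : set (form V)) a b : directed F ->
    D `<=` \bigcup_(X in F) X ->
    (forall G : set (set (form V)), directed G ->
      D `|` [set a] `<=` \bigcup_(X in G) X -> exists2 X, G X & derives X b) ->
    exists2 X, F X & derives (X `|` [set a]) b.
  move=> dirF DF /(_ _ (directed_setU [set a] dirF))[|_ [X FX <-]]; last first.
    by exists X.
  have [[X FX] _] := dirF.
  move=> c [/DF[Y FY Yc]|->]; last first.
    by exists (X `|` [set a]); [exists X | right].
  by exists (Y `|` [set a]); [exists Y | left].
elim=> {Gamma phi}.
- by move=> D a Da F _ /(_ a Da)[X FX Xa]; exists X => //; apply: der_hyp.
- move=> D a b _ IH F dirF DF.
  have [X FX Xb] := disch _ _ _ _ dirF DF IH.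
  by exists X => //; apply: der_ImpI.
all: try by move=> D a b _ IH1 _ IH2 F dirF DF;
  have [X FX [X1 X2]] := directed_and dirF (up _) (up _)
    (IH1 F dirF DF) (IH2 F dirF DF);
  exists X => //; econstructor; eauto.
all: try by move=> D a b _ IH F dirF DF;
  have [X FX X1] := IH F dirF DF; exists X => //; econstructor; eauto.
all: try by move=> D a b _ IH1 _ IH2 _ IH3 F dirF DF;
  have [X FX [X1 [X2 X3]]] := directed_and dirF (up _)
    (upward_and (up _) (up _)) (IH1 F dirF DF)
    (directed_and dirF (up _) (up _) (IH2 F dirF DF) (IH3 F dirF DF));
  exists X => //; econstructor; eauto.
- move=> D a b c _ IH _ IHa _ IHb F dirF DF.
  have [X FX [Xab [Xa Xb]]] := directed_and dirF (up _)
    (upward_and (upU _ _) (upU _ _)) (IH F dirF DF)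
    (directed_and dirF (upU _ _) (upU _ _)
      (disch _ _ _ _ dirF DF IHa) (disch _ _ _ _ dirF DF IHb)).
  by exists X => //; apply: der_OrE Xab Xa Xb.
- move=> D a b _ IH1 _ IH2 F dirF DF.
  have [X FX [X1 X2]] := directed_and dirF (upU _ _) (upU _ _)
    (disch _ _ _ _ dirF DF IH1) (disch _ _ _ _ dirF DF IH2).
  by exists X => //; apply: der_NegI X1 X2.
- move=> D a b _ IH1 _ IH2 F dirF DF.
  have [X FX [X1 X2]] := directed_and dirF (upU _ _) (upU _ _)
    (disch _ _ _ _ dirF DF IH1) (disch _ _ _ _ dirF DF IH2).
  by exists X => //; apply: der_RAA X1 X2.
- by move=> D a F [[X FX] _] _; exists X => //; apply: der_DB.
all: try by move=> D a _ IH F dirF DF;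
  have [X FX X1] := IH F dirF DF; exists X => //; econstructor; eauto.
- by move=> D a d _ F [[X FX] _] _; exists X => //; apply: der_IB.
Qed.

(** * Classical derivations *)

Lemma derives_cut (V : Type) (Gamma : set (form V)) (phi psi : form V) :
  derives Gamma phi -> derives (Gamma `|` [set phi]) psi -> derives Gamma psi.
Proof. by move=> Gphi /der_ImpI; move/der_MP; apply. Qed.

Lemma derives_explosion (V : Type) (Gamma : set (form V)) (phi psi : form V) :
  derives Gamma phi -> derives Gamma (Neg phi) -> derives Gamma psi.
Proof.
move=> Gp Gn; apply: (@der_RAA _ _ _ phi).
  by apply: weakening Gp _; apply: subsetUl.
by apply: weakening Gn _; apply: subsetUl.
Qed.

Lemma derives_EM (V : Type) (Gamma : set (form V)) (phi : form V) :
  derives Gamma (Or (Neg phi) phi).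
Proof. by apply: der_ImpI; apply: der_hyp; right. Qed.

Lemma derives_cases (V : Type) (Gamma : set (form V)) (phi psi : form V) :
  derives (Gamma `|` [set phi]) psi -> derives (Gamma `|` [set Neg phi]) psi ->
  derives Gamma psi.
Proof. by move=> Gp Gn; apply: der_OrE (derives_EM Gamma phi) Gn Gp. Qed.

(** * Complete theories *)

Record complete_theory (V : Type) (Delta : set (form V)) : Prop :=
    CompleteTheory {
  complete_closed : forall chi, derives Delta chi -> Delta chi;
  complete_Neg : forall chi, Delta (Neg chi) <-> ~ Delta chi
}.

(** Zorn's lemma is applied to the extensions [X] for which [Gamma `|` X] does
    not derive [phi].  A set that is maximal with this property is complete:
    if both [a] and [Neg a] were missing from it, then adding either would
    allow [phi] to be derived, so [phi] would already be derivable by the law of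
    excluded middle. *)
Lemma lindenbaum (V : Type) (Gamma : set (form V)) (phi : form V) :
  ~ derives Gamma phi ->
  exists Delta, [/\ complete_theory Delta, Gamma `<=` Delta & ~ Delta phi].
Proof.
move=> Gphi; pose P (X : set (form V)) := ~ derives (Gamma `|` X) phi.
have [|M [PM maxM]] := @Zorn_bigcup _ P.
  move=> F FP totF /compactness.
  (* [set0] is added because the chain [F] may be empty. *)
  case/(_ [set Gamma `|` X | X in set0 |` F]).
  - split; first by exists (Gamma `|` set0), set0 => //; left.
    move=> _ _ [X FX <-] [Y FY <-].
    have [XY|YX] : X `<=` Y \/ Y `<=` X.
    + case: FX FY => [->|FX]; first by left.
      by case=> [->|FY]; [right | apply: totF].
    + by exists (Gamma `|` Y); split=> //; [exists Y | apply: setUS].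
    + by exists (Gamma `|` X); split=> //; [exists X | apply: setUS].
  - move=> a [Ga|[X FX Xa]].
      by exists (Gamma `|` set0); [exists set0 => //; left | left].
    by exists (Gamma `|` X); [exists X => //; right | right].
  - move=> _ [X [->|FX] <-]; first by rewrite setU0.
    exact: FP.
pose D := Gamma `|` M.
have ext a : ~ D a -> derives (D `|` [set a]) phi.
  move=> Da; apply: contrapT => na; apply: (maxM (M `|` [set a])).
    by split=> [|sub]; [left | apply: Da; right; apply: sub; right].
  by rewrite /P setUA.
have clD a : derives D a -> D a.
  move=> Dda; apply: contrapT => /ext; apply: contra_not PM.
  exact: derives_cut.
exists D; split=> //; last by move/der_hyp.
- split=> // a; split=> [Dn Da|Da].
    by apply: PM; apply: (@derives_explosion _ _ a); apply: der_hyp.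
  apply: contrapT => /ext Dn; apply: PM; exact: derives_cases (ext _ Da) Dn.
- by left.
Qed.

(** * Replacement of equivalents under Circ *)

Lemma derives_weak1 (V : Type) (D : set (form V)) (a b : form V) :
  derives [set a] b -> derives (D `|` [set a]) b.
Proof. by move=> d; apply: weakening d _; apply: subsetUr. Qed.

(** If [a] and [b] are equivalent, then [And b (Neg a)] is refutable and
    [Or b (Neg a)] is provable, so (IB) and (BR) give [Circ] of both.  Were
    [Circ a], hence [Circ (Neg a)], to hold without [Circ b], then (NB), applied
    to [b] and [Neg a], would deny one of the two. *)
Lemma Circ_replacement (V : Type) (D : set (form V)) (a b : form V) :
  derives [set a] b -> derives [set b] a ->
  derives D (Circ a) -> derives D (Circ b).
Proof.
move=> ab ba Da; apply: (@derives_cases _ _ (Circ b)).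
  by apply: der_hyp; right.
set E := D `|` _.
have Eb : derives E (Neg (Circ b)) by apply: der_hyp; right.
have Ea : derives E (Circ (Neg a)).
  by apply: der_BR1; apply: weakening Da _; apply: subsetUl.
have meet0 : derives set0 (Neg (And b (Neg a))).
  apply: (@der_NegI _ _ _ a).
    apply: (@derives_cut _ _ b); last exact: derives_weak1.
    by apply: (@der_AndE1 _ _ _ (Neg a)); apply: der_hyp; right.
  by apply: (@der_AndE2 _ _ b); apply: der_hyp; right.
have join1 : derives set0 (Or b (Neg a)).
  apply: (@derives_cases _ _ a); first exact/der_OrI1/derives_weak1.
  by apply: der_OrI2; apply: der_hyp; right.
apply: der_OrE (der_NB Eb Ea) _ _.
- apply: (@derives_explosion _ _ (Circ (And b (Neg a)))).
    by apply: der_BR2; apply: der_IB.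
  by apply: der_hyp; right.
- apply: (@derives_explosion _ _ (Circ (Or b (Neg a)))); first exact: der_IB.
  by apply: der_hyp; right.
Qed.

Lemma And_comm (V : Type) (a b : form V) : derives [set And a b] (And b a).
Proof.
by apply: der_AndI; [apply: (@der_AndE2 _ _ a) | apply: (@der_AndE1 _ _ _ b)];
  apply: der_hyp.
Qed.

Lemma Circ_AndC (V : Type) (D : set (form V)) (a b : form V) :
  derives D (Circ (And a b)) -> derives D (Circ (And b a)).
Proof. by apply: Circ_replacement; apply: And_comm. Qed.

Lemma de_morgan_Or (V : Type) (a b : form V) :
  derives [set Or a b] (Neg (And (Neg a) (Neg b))).
Proof.
apply: (@der_OrE _ _ a b); first exact: der_hyp.
- apply: (@der_NegI _ _ _ a); first by apply: der_hyp; left; right.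
  by apply: (@der_AndE1 _ _ _ (Neg b)); apply: der_hyp; right.
- apply: (@der_NegI _ _ _ b); first by apply: der_hyp; left; right.
  by apply: (@der_AndE2 _ _ (Neg a)); apply: der_hyp; right.
Qed.

Lemma Or_de_morgan (V : Type) (a b : form V) :
  derives [set Neg (And (Neg a) (Neg b))] (Or a b).
Proof.
apply: (@derives_cases _ _ a); first by apply: der_OrI1; apply: der_hyp; right.
apply: (@derives_cases _ _ b); first by apply: der_OrI2; apply: der_hyp; right.
apply: (@derives_explosion _ _ (And (Neg a) (Neg b))).
  by apply: der_AndI; apply: der_hyp; [left; right | right].
by apply: der_hyp; left; left.
Qed.

Lemma Circ_Or (V : Type) (D : set (form V)) (a b : form V) :
  derives D (Circ (Or a b)) <-> derives D (Circ (And (Neg a) (Neg b))).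
Proof.
split=> [Dab|/der_BR1 Dab].
  apply: der_BR2; apply: Circ_replacement Dab;
    [exact: de_morgan_Or | exact: Or_de_morgan].
apply: Circ_replacement Dab; [exact: Or_de_morgan | exact: de_morgan_Or].
Qed.

(** * The canonical valuation *)

Section CanonicalValuation.
Context (V : Type) (D : set (form V)) (compD : complete_theory D).

Definition truth (chi : form V) : bool := `[< D chi >].

Lemma truthP (chi : form V) : reflect (derives D chi) (truth chi).
Proof.
apply: (iffP idP) => [/asboolP/der_hyp//|/(complete_closed compD)].
by move/asboolP.
Qed.

Lemma truth_Neg (a : form V) : truth (Neg a) = ~~ truth a.
Proof.
apply/idP/idP; first by move/asboolP/(complete_Neg compD)/asboolPn.
by move/asboolPn/(complete_Neg compD)/asboolP.
Qed.

Lemma truth_NegP (a : form V) : reflect (derives D (Neg a)) (~~ truth a).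
Proof. by rewrite -truth_Neg; apply: truthP. Qed.

Lemma truth_And (a b : form V) : truth (And a b) = truth a && truth b.
Proof.
apply/truthP/andP => [Dab|[/truthP Da /truthP Db]]; last exact: der_AndI.
by split; apply/truthP; [apply: der_AndE1 Dab | apply: der_AndE2 Dab].
Qed.

Lemma truth_Or (a b : form V) : truth (Or a b) = truth a || truth b.
Proof.
apply/idP/orP => [|[]/truthP d]; last 2 first.
- exact/truthP/der_OrI1.
- exact/truthP/der_OrI2.
move=> ab; have [ta|/truth_NegP Da] := boolP (truth a); first by left.
right; apply/truthP; apply: der_OrE (truthP _ ab) _ _; last first.
  by apply: der_hyp; right.
apply: (@derives_explosion _ _ a); first by apply: der_hyp; right.
by apply: weakening Da _; apply: subsetUl.
Qed.

Lemma truth_Circ_Neg (a : form V) : truth (Circ (Neg a)) = truth (Circ a).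
Proof. by apply/truthP/truthP => [/der_BR2|/der_BR1]. Qed.

Lemma truth_Circ_AndC (a b : form V) :
  truth (Circ (And a b)) = truth (Circ (And b a)).
Proof. by apply/truthP/truthP; apply: Circ_AndC. Qed.

Definition canonical (chi : form V) : B4 :=
  (truth chi, truth chi == truth (Circ chi)).

(** If [b] is false, (NwB) gives [Circ (And b a)].  If [b] is true, (AwB) gives
    [Circ (Or b a)], and then of the two alternatives of (NB) only
    [Neg (Circ (And a b))] remains. *)
Lemma truth_Circ_And_mixed (a b : form V) :
  ~~ truth (Circ a) -> truth (Circ b) ->
  truth (Circ (And a b)) = ~~ truth b.
Proof.
move=> /truth_NegP ca /truthP cb.
apply/idP/idP => [cab|/truth_NegP nb]; last first.
  by rewrite truth_Circ_AndC; apply/truthP; apply: der_NwB.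
apply/negP => /truthP tb.
have cba : truth (Circ (Or b a)) by apply/truthP; apply: der_AwB.
have coab : truth (Circ (Or a b)).
  apply/truthP; move/truthP: cba.
  by move/Circ_Or/Circ_AndC/Circ_Or.
have := truthP _ (introT (truthP _) (der_NB ca cb)).
by move/truthP; rewrite truth_Or !truth_Neg cab coab.
Qed.

(** Two values of [B4] whose coordinates disagree are either equal or
    complementary, according to their first coordinates.  Their meet is
    respectively the common value or the bottom element; (TNB1) and (TNB2)
    express the first case, (OV) the second. *)
Lemma truth_Circ_And_gap (a b : form V) :
  ~~ truth (Circ a) -> ~~ truth (Circ b) ->
  truth (Circ (And a b)) = (truth a != truth b).
Proof.
move=> ca cb; move/truth_NegP: (ca) => dca; move/truth_NegP: (cb) => dcb.
have [eq_ab|neq_ab] := eqVneq (truth a) (truth b) => /=.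
  apply/negbTE/truth_NegP; case ta: (truth a) eq_ab => /esym tb.
    by apply: der_TNB1 => //; apply/truthP; rewrite truth_And ta tb.
  by apply: der_TNB2 => //; apply/truth_NegP; rewrite truth_Or ta tb.
apply/truthP/der_OV; apply/truthP.
  by rewrite /Iff /Imp truth_And !truth_Or !truth_Neg ca cb.
rewrite /Iff /Imp truth_And !truth_Or !truth_Neg.
by case: (truth a) (truth b) neq_ab => [] [].
Qed.

Lemma canonical_And (a b : form V) :
  canonical (And a b) = Order.meet (canonical a) (canonical b).
Proof.
apply: B4_eq; rewrite B4E /= truth_And //.
case ca: (truth (Circ a)); case cb: (truth (Circ b)).
- have -> : truth (Circ (And a b)).
    by apply/truthP; apply: der_BF_And; apply/truthP.
  by case: (truth a) (truth b) => [] [].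
- rewrite truth_Circ_AndC truth_Circ_And_mixed ?cb //.
  by case: (truth a) (truth b) => [] [].
- rewrite truth_Circ_And_mixed ?ca //.
  by case: (truth a) (truth b) => [] [].
- rewrite truth_Circ_And_gap ?ca ?cb //.
  by case: (truth a) (truth b) => [] [].
Qed.

Lemma canonical_Neg (a : form V) :
  canonical (Neg a) = Order.compl (canonical a).
Proof.
apply: B4_eq; rewrite B4E /= truth_Neg // truth_Circ_Neg.
by case: (truth a) (truth (Circ a)) => [] [].
Qed.

Lemma canonical_Or (a b : form V) :
  canonical (Or a b) = Order.join (canonical a) (canonical b).
Proof.
have -> : canonical (Or a b) = canonical (Neg (And (Neg a) (Neg b))).
  apply: B4_eq; rewrite /= ?truth_Circ_Neg truth_Neg truth_And !truth_Neg;
    rewrite -negb_or negbK truth_Or //.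
  by congr (_ == _); apply/truthP/truthP => /Circ_Or.
rewrite canonical_Neg canonical_And !canonical_Neg.
by apply: B4_eq; rewrite !B4E -negb_or negbK.
Qed.

Lemma canonical_Circ (a : form V) : canonical (Circ a) = ocirc (canonical a).
Proof.
have cca : truth (Circ (Circ a)) by apply/truthP; apply: der_DB.
apply: B4_eq; rewrite B4E /= ?cca;
  by case: (truth a) (truth (Circ a)) => [] [].
Qed.

Lemma canonical_valuation : valuation canonical.
Proof.
split; [exact: canonical_Neg | exact: canonical_Circ |
        exact: canonical_Or | exact: canonical_And].
Qed.

End CanonicalValuation.

Lemma completeness (V : Type) (Gamma : set (form V)) (phi : form V) :
  entails coord1_set Gamma phi -> derives Gamma phi.
Proof.
move=> ent; apply: contrapT => /lindenbaum[D [compD GD Dphi]].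
apply: Dphi; apply/asboolP.
by apply: (ent _ (canonical_valuation compD)) => g /GD/asboolP.
Qed.

Theorem theorem2p1 (V : Type) (U : set B4) (hU : lattice_ultrafilter U)
    (Gamma : set (form V)) (phi : form V) :
  entails U Gamma phi <-> derives Gamma phi.
Proof.
have main : entails coord1_set Gamma phi <-> derives Gamma phi.
  by split; [apply: completeness | apply: soundness].
by case: (B4_ultrafilter hU) => ->; rewrite ?entails_swap.
Qed.
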